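(* Let $g>0$ and $\lambda\ge 0$ be real numbers, let $Y'$ be a random variable with the non-central chi-squared distribution $\chi'^{\,2}_g(\lambda)$ with $g$ degrees of freedom and non-centrality parameter $\lambda$, and let $h=g/2$. Then for every integer $r\ge 1$, $$\mathbb{E}\left[(Y')^r\right]=2^{r}\sum_{i=0}^{r}\sum_{j=0}^{i}\mathcal{S}(i,j)\,\frac{1}{i!}\left[\frac{d^{\,i}}{dh^i}(h)_r\right]\left(\frac{\lambda}{2}\right)^j ,$$ where $\mathcal{S}(i,j)$ is the Stirling number of the second kind and $\frac{d^{\,i}}{dh^i}(h)_r$ is the $i$-th derivative of the function $h\mapsto (h)_r$ evaluated at $h=g/2$ (the case $i=0$ being $(h)_r$ itself).
   Context: For $a>0$ and an integer $l\ge 0$, $(a)_l=\Gamma(a+l)/\Gamma(a)$ denotes the ascending factorial (Pochhammer symbol): $(a)_0=1$ and $(a)_l=a(a+1)\cdots(a+l-1)$ for $l\ge 1$. For $g>0$ and $\lambda\ge 0$, the non-central chi-squared distribution $\chi'^{\,2}_g(\lambda)$ is the mixture law: $Y'\sim\chi'^{\,2}_g(\lambda)$ means that, for some $M\sim\mathrm{Poisson}(\lambda/2)$ (that is, $P(M=j)=e^{-\lambda/2}(\lambda/2)^j/j!$ for $j\ge 0$; $M=0$ almost surely if $\lambda=0$), the conditional distribution of $Y'$ given $M$ is the (central) chi-squared distribution with $g+2M$ degrees of freedom. Conventions: $\mathcal{S}(0,0)=1$, $\mathcal{S}(i,0)=0$ for $i\ge1$, and $(\lambda/2)^0=1$. 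*)

(* Defs.v *)
From HB Require Import structures.
From mathcomp Require Import all_boot all_order all_algebra.

Set Implicit Arguments.
Unset Strict Implicit.
Unset Printing Implicit Defensive.

Import Order.TTheory GRing.Theory Num.Theory.

(* Stirling number of the second kind, stated before all_classical is imported because
   classical_sets defines another [partition]. The empty set has the empty partition,
   so stirling2 0 0 = 1. *)
Definition stirling2 (n k : nat) : nat :=
  #|[set Q : {set {set 'I_n}} | partition Q [set: 'I_n] & #|Q| == k]|.

From mathcomp Require Import all_classical all_reals all_analysis.

Import numFieldNormedType.Exports.

Local Open Scope classical_set_scope.
Local Open Scope ring_scope.

Definition pochhammer (R : realType) (l : nat) (a : R) : R :=
  \prod_(k < l) (a + k%:R).

Definition Gamma (R : realType) (a : R) : R :=
  Rintegral lebesgue_measure `]0, +oo[ (fun x : R => x `^ (a - 1) * expR (- x)).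

Definition chi2_pdf (R : realType) (k x : R) : R :=
  if 0 < x then
    x `^ (k / 2 - 1) * expR (- x / 2) / (2 `^ (k / 2) * Gamma (k / 2))
  else 0.

Definition chi2_prob (R : realType) (k : R) (A : set R) : \bar R :=
  (\int[lebesgue_measure]_(x in A) (chi2_pdf k x)%:E)%E.

(* M lives on an auxiliary probability space: being noncentral chi-squared is a
   property of the law mu alone, and the space carrying a given variable with law mu
   need not also carry a suitable M.
   The nat argument of poisson_prob is unused by the library; poisson_prob 0 _ is the
   Dirac mass at 0.
   The last conjunct says that Y given M is chi-squared with g + 2 M degrees of
   freedom, multiplied by P(M = j) since this may vanish. *)
Definition noncentral_chi2 (R : realType) (g lambda : R)
    (mu : set R -> \bar R) : Prop :=
  exists (d : measure_display) (T : measurableType d) (P : probability T R)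
         (Y : {RV P >-> R}) (M : {RV P >-> nat}),
    [/\ forall A, measurable A -> distribution P Y A = mu A,
        forall B, distribution P M B = poisson_prob (lambda / 2) 0%N B
      & forall (j : nat) (A : set R), measurable A ->
          P (M @^-1` [set j] `&` Y @^-1` A) =
          (P (M @^-1` [set j]) * chi2_prob (g + 2 * j%:R)%R A)%E].

(* Main.v *)
Require Import Defs.
From mathcomp Require Import all_boot all_order all_algebra.

(** The law of [Y] is a Poisson mixture of chi-squared laws, so its [r]-th moment is
    the Poisson mean, over [j], of the [r]-th moment of the chi-squared law with
    [g + 2 * j] degrees of freedom. With [h = g / 2], the Gamma function evaluates
    the latter to [2 ^+ r * Gamma (h + j + r) / Gamma (h + j)], that is, [2 ^+ r]
    times the rising factorial of length [r] at [h + j] ([chi2_moment]).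

    The rising factorial is a polynomial, so its Taylor expansion at [h] gives
    ([pochhammer_taylor]) a sum over [i <= r] of its [i]-th derivative at [h],
    divided by [i`!], times [j ^ i]. It remains to know the [i]-th moment of the
    Poisson law of mean [mu = lambda / 2]. The identity
    [m ^ n = \sum_k stirling2 n k * m ^_ k] ([expn_stirling2]) reduces it to
    factorial moments, and the [k]-th factorial moment is simply [mu ^+ k]
    ([poisson_factorial_moment]). This yields the double sum of the statement
    ([poisson_pochhammer]).

    On the analytic side, the functional equation of Gamma is proved by
    integration by parts on compact intervals that exhaust the half-line
    ([egammaS]), and the mixture is integrated termwise by
    [noncentral_chi2_integral]. *)

Set Implicit Arguments.
Unset Strict Implicit.
Unset Printing Implicit Defensive.

(** * Powers and Stirling numbers of the second kind *)

(** A map is constant on the blocks of its kernel partition and separates distinct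
    blocks, so the maps with kernel [Q] are the injections of the blocks of [Q]
    into [D]. *)
Lemma card_preim_partition (T D : finType) (Q : {set {set T}}) :
  partition Q [set: T] ->
  #|[set f : {ffun T -> D} | preim_partition f [set: T] == Q]| = #|D| ^_ #|Q|.
Proof.
move=> parQ.
have covQ x : x \in cover Q by rewrite (cover_partition parQ).
have tiQ := partition_trivIset parQ.
pose S := {B : {set T} | B \in Q}.
pose blk x : S := exist _ (pblock Q x) (pblock_mem (covQ x)).
pose Phi (g : {ffun S -> D}) : {ffun T -> D} := [ffun x => g (blk x)].
have reprS (B : S) : {x | blk x = B}.
  case: B => B QB; have /set0Pn/sigW[x xB] : B != set0.
    by apply: (partition_neq0 parQ).
  by exists x; apply: val_inj => /=; exact: def_pblock tiQ QB xB.
have Phi_inj : injective Phi.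
  move=> g1 g2 /ffunP eg; apply/ffunP => B.
  have [x <-] := reprS B.
  by have := eg x; rewrite !ffunE.
have blkE x y : (blk x == blk y) = (y \in pblock Q x).
  by rewrite -val_eqE /= eq_pblock.
rewrite -[#|Q|]card_sig -card_inj_ffuns -(card_imset _ Phi_inj).
congr (#|pred_of_set _|); apply/setP => f; rewrite inE.
apply/eqP/imsetP => [defQ|[g]].
  have fE x y : (f x == f y) = (blk x == blk y).
    rewrite blkE -defQ pblock_equivalence_partition ?inE //.
    by split=> // /eqP->.
  exists [ffun B => f (sval (reprS B))].
    rewrite inE; apply/injectiveP => B1 B2; rewrite !ffunE => /eqP.
    rewrite fE => /eqP.
    by case: (reprS B1) (reprS B2) => x1 /= -> [x2 /= ->].
  apply/ffunP => x; rewrite !ffunE; apply/eqP; rewrite fE.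
  by case: (reprS _) => y /= ->.
rewrite inE => /injectiveP g_inj ->.
rewrite -[RHS](equivalence_partition_pblock parQ).
rewrite /preim_partition; apply: eq_in_imset => x _; apply/setP => y.
by rewrite !inE /= !ffunE (inj_eq g_inj) blkE.
Qed.

(** Sorting the [m ^ n] maps between finite sets by their kernel partition, and
    these partitions by their number of blocks, expands powers in falling
    factorials. *)
Lemma expn_stirling2 (m n : nat) :
  m ^ n = \sum_(0 <= k < n.+1) stirling2 n k * m ^_ k.
Proof.
have -> : m ^ n = #|{: {ffun 'I_n -> 'I_m}}| by rewrite card_ffun !card_ord.
rewrite -sum1_card.
rewrite (partition_big
  (fun f : {ffun 'I_n -> 'I_m} => preim_partition f [set: 'I_n])
  (fun Q => partition Q [set: 'I_n])) /=; last first.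
  by move=> f _; apply: preim_partitionP.
under eq_bigr => Q parQ.
  rewrite sum1dep_card card_preim_partition // card_ord.
  over.
rewrite big_mkord.
have cardQ (Q : {set {set 'I_n}}) : partition Q [set: 'I_n] -> #|Q| < n.+1.
  move=> /transversalP /card_transversal <-.
  by rewrite ltnS -[X in _ <= X]card_ord max_card.
rewrite (partition_big
  (fun Q : {set {set 'I_n}} => inord #|Q| : 'I_n.+1) predT) //=.
apply: eq_bigr => k _; rewrite /stirling2 -sum1dep_card big_distrl /=.
apply: eq_big => [Q|Q /andP[parQ /eqP <-]].
  apply: andb_id2l => /cardQ ltQ.
  by rewrite -val_eqE /= inordK.
by rewrite mul1n inordK // cardQ.
Qed.

From mathcomp Require Import all_classical all_reals all_analysis.
From mathcomp Require Import measurable_realfun ring lra.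
Import Order.TTheory GRing.Theory Num.Theory.
Import numFieldNormedType.Exports.

Local Open Scope classical_set_scope.
Local Open Scope ring_scope.

(** * Rising factorials and moments of the Poisson law *)

Lemma derive1n_horner (R : realFieldType) (p : {poly R}) (n : nat) :
  derive1n n (horner p) = horner p^`(n).
Proof.
elim: n => [|n IH]; first by rewrite derivn0.
by rewrite derive1nS IH derivnS derivE.
Qed.

Lemma pochhammerE (R : realType) (r : nat) :
  @pochhammer R r = horner (\prod_(k < r) ('X + k%:R%:P)).
Proof.
apply/funext => x; rewrite /pochhammer horner_prod.
by apply: eq_bigr => k _; rewrite !hornerE.
Qed.

(** The rising factorial is a polynomial of degree [r], hence equal to its Taylor
    expansion of order [r]. *)
Lemma pochhammer_taylor (R : realType) (r : nat) (h x : R) :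
  pochhammer r (h + x) =
  \sum_(0 <= i < r.+1) (i`!%:R)^-1 * derive1n i (@pochhammer R r) h * x ^+ i.
Proof.
rewrite pochhammerE addrC; set p := \prod_(k < r) _.
have size_p : (size p <= r.+1)%N.
  rewrite /p; under eq_bigr do rewrite -[_%:P]opprK -polyCN.
  by rewrite size_prod_XsubC /index_enum -enumT size_enum_ord.
rewrite addrC (nderiv_taylor_wide (mulrC _ _) size_p) big_mkord.
apply: eq_bigr => i _; rewrite derive1n_horner nderivn_def hornerMn.
rewrite -[_.[h] *+ _]mulr_natl.
by rewrite mulKf // pnatr_eq0 -lt0n fact_gt0.
Qed.

(** The Poisson probability of [j]; as [0 ^+ 0 = 1], this is the unit mass at 0
    when [mu = 0], so that the degenerate case needs no separate treatment. *)
Definition poisson_weight (R : realType) (mu : R) (j : nat) : R :=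
  expR (- mu) * (mu ^+ j / j`!%:R).

Lemma poisson_weight_ge0 (R : realType) (mu : R) (j : nat) :
  0 <= mu -> 0 <= poisson_weight mu j.
Proof. by move=> mu0; rewrite mulr_ge0 ?expR_ge0 // divr_ge0 // exprn_ge0. Qed.

Lemma poisson_prob1 (R : realType) (mu : R) (j : nat) : 0 <= mu ->
  poisson_prob mu 0 [set j] = (poisson_weight mu j)%:E.
Proof.
rewrite /poisson_prob /poisson_weight le_eqVlt => /predU1P[<-|mu0].
  rewrite ltxx oppr0 expR0 mul1r diracE expr0n.
  case: j => [|j]; first by rewrite mem_set // fact0 divr1.
  by rewrite memNset // mul0r.
rewrite mu0 esum_set1 ?lee_fin ?poisson_pmf_ge0 // /poisson_pmf mu0.
by rewrite [in RHS]mulrC.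
Qed.

(** Since [j ^_ k / j`! = 1 / (j - k)`!] for [k <= j], the series consists of [k]
    zeros followed by [mu ^+ k * expR (- mu)] times the exponential series. *)
Lemma poisson_factorial_moment (R : realType) (mu : R) (k : nat) :
  series (fun j => poisson_weight mu j * (j ^_ k)%:R) @ \oo --> mu ^+ k.
Proof.
rewrite -(cvg_shiftn k).
have -> : (fun n =>
      series (fun j => poisson_weight mu j * (j ^_ k)%:R) (n + k)) =
    (fun n => mu ^+ k * expR (- mu) * series (exp_coeff mu) n).
  apply/funext => n; rewrite /series /= (@big_cat_nat _ _ _ k) ?leq_addl //=.
  rewrite big1_seq ?add0r => [|j /andP[_]]; last first.
    by rewrite mem_index_iota => /ffact_small ->; rewrite mulr0.
  rewrite -{1}[k]add0n big_addn addnK mulr_sumr; apply: eq_bigr => j _.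
  rewrite /poisson_weight /exp_coeff /= exprD.
  have <- := ffact_fact (leq_addl j k); rewrite addnK natrM.
  field.
  by rewrite !pnatr_eq0 -!lt0n fact_gt0 ffact_gt0 leq_addl.
have E : mu ^+ k = mu ^+ k * expR (- mu) * expR mu.
  by rewrite -mulrA [expR (- mu) * _]mulrC expRxMexpNx_1 mulr1.
rewrite [in X in _ --> X]E.
by apply: cvgMl_tmp; exact: is_cvg_series_exp_coeff.
Qed.

Lemma poisson_moment (R : realType) (mu : R) (n : nat) :
  series (fun j => poisson_weight mu j * (j ^ n)%:R) @ \oo -->
  \sum_(0 <= k < n.+1) (stirling2 n k)%:R * mu ^+ k.
Proof.
have -> : series (fun j => poisson_weight mu j * (j ^ n)%:R) = (fun N =>
    \sum_(0 <= k < n.+1) (stirling2 n k)%:R *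
      series (fun j => poisson_weight mu j * (j ^_ k)%:R) N).
  apply/funext => N; rewrite /series /=.
  under [RHS]eq_bigr do rewrite mulr_sumr.
  rewrite exchange_big_nat /=; apply: eq_bigr => j _.
  rewrite expn_stirling2 natr_sum mulr_sumr; apply: eq_bigr => k _.
  by rewrite natrM mulrCA.
apply: (cvg_big (op := +%R) (x0 := 0)) => [|k _]; first exact: add_continuous.
apply: cvgMl_tmp; exact: poisson_factorial_moment.
Qed.

(** This is the combinatorial content of the moment formula: Taylor expansion at
    [h] turns the mean of the rising factorial into the raw moments of the
    Poisson law, which the Stirling numbers express by its factorial moments. *)
Lemma poisson_pochhammer (R : realType) (mu h : R) (r : nat) :
  series (fun m => poisson_weight mu m * pochhammer r (h + m%:R)) @ \oo -->
  \sum_(0 <= i < r.+1) \sum_(0 <= j < i.+1)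
     (stirling2 i j)%:R * (i`!%:R)^-1 * derive1n i (@pochhammer R r) h
       * mu ^+ j.
Proof.
have -> : series (fun m => poisson_weight mu m * pochhammer r (h + m%:R)) =
  (fun N => \sum_(0 <= i < r.+1)
      ((i`!%:R)^-1 * derive1n i (@pochhammer R r) h) *
      series (fun m => poisson_weight mu m * (m ^ i)%:R) N).
  apply/funext => N; rewrite /series /=.
  under [RHS]eq_bigr do rewrite mulr_sumr.
  rewrite exchange_big_nat /=; apply: eq_bigr => m _.
  rewrite pochhammer_taylor mulr_sumr; apply: eq_bigr => i _.
  by rewrite natrX mulrCA.
apply: (cvg_big (op := +%R) (x0 := 0)) => [|i _]; first exact: add_continuous.
have -> : \sum_(0 <= j < i.+1) (stirling2 i j)%:R * i`!%:R^-1 *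
    derive1n i (@pochhammer R r) h * mu ^+ j =
    (i`!%:R)^-1 * derive1n i (@pochhammer R r) h *
    \sum_(0 <= j < i.+1) (stirling2 i j)%:R * mu ^+ j.
  rewrite mulr_sumr; apply: eq_bigr => j _.
  by rewrite -!mulrA mulrCA; congr (_ * _); rewrite mulrCA.
apply: cvgMl_tmp; exact: poisson_moment.
Qed.

(** * The Gamma function *)

(** Exhausting the half-line by compact intervals lets integration by parts and
    change of variables be applied away from 0, where the Gamma integrand may be
    unbounded. The scale [c] leaves room for the substitution [x = 2 * y], and
    the shift by 2 makes every interval with [c = 1] nondegenerate. *)
Lemma cvg_integral_exhaustion (R : realType) (f : R -> R) (c : R) : 0 < c ->
  measurable_fun `](0 : R), +oo[ f -> (forall x : R, 0 < x -> 0 <= f x) ->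
  (\int[lebesgue_measure]_(x in `[(c / n.+2%:R)%R, (c * n.+2%:R)%R]) (f x)%:E
    @[n --> \oo] --> \int[lebesgue_measure]_(x in `]0%R, +oo[) (f x)%:E)%E.
Proof.
move=> c0 mf f0.
pose F n : set R := `[c / n.+2%:R, c * n.+2%:R]%classic.
have FS n : F n `<=` `]0, +oo[.
  move=> x; rewrite /F /= !in_itv /= andbT => /andP[+ _].
  by apply: lt_le_trans; rewrite divr_gt0.
have FN m n : (m <= n)%N -> F m `<=` F n.
  move=> mn x; rewrite /F /= !in_itv /= => /andP[h1 h2]; apply/andP; split.
    by apply: le_trans h1; rewrite ler_pM2l // lef_pV2 ?posrE // ler_nat !ltnS.
  by apply: (le_trans h2); rewrite ler_pM2l // ler_nat !ltnS.
have E n : (\int[lebesgue_measure]_(x in F n) (f x)%:E =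
    \int[lebesgue_measure]_(x in `]0%R, +oo[) ((EFin \o f) \_ (F n)) x)%E.
  by rewrite -integral_mkcondr setIidr.
under eq_cvg do rewrite E.
have limF x : `]0, +oo[%classic x ->
    ((EFin \o f) \_ (F n)) x @[n --> \oo] --> (f x)%:E.
  rewrite /= in_itv /= andbT => x0; apply: cvg_near_cst; near=> n.
  have n2 : (n%:R <= n.+2%:R :> R) by rewrite ler_nat leqW // leqW.
  have h1 : c / x <= n.+2%:R.
    by apply: le_trans n2; near: n; exact: nbhs_infty_ger.
  have h2 : x / c <= n.+2%:R.
    by apply: le_trans n2; near: n; exact: nbhs_infty_ger.
  rewrite patchE mem_set //= /F /= in_itv /= ler_pdivrMr // [x * _]mulrC.
  by rewrite -ler_pdivrMr // h1 [c * _]mulrC -ler_pdivrMr.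
rewrite (_ : integral _ _ _ = \int[lebesgue_measure]_(x in `]0%R, +oo[)
   limn (fun n => ((EFin \o f) \_ (F n)) x))%E; last first.
  by apply: eq_integral => x /[!inE] /limF /cvg_lim ->.
apply: cvg_monotone_convergence => //.
- move=> n; apply/measurable_restrict => //; first exact: measurable_itv.
  by rewrite setIidr //; apply/measurable_EFinP; apply: measurable_funS mf.
- move=> n x; rewrite /= in_itv /= andbT => /f0 fx; rewrite patchE.
  by case: ifP => // _; rewrite lee_fin.
- move=> x; rewrite /= in_itv /= andbT => /f0 fx m n mn; rewrite !patchE.
  case: ifPn => [/set_mem /(FN _ _ mn) /mem_set -> //|_].
  by case: ifP => // _; rewrite lee_fin.
Unshelve. all: by end_near. Qed.

Definition gamma_integrand (R : realType) (a x : R) : R :=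
  x `^ (a - 1) * expR (- x).

(** The Gamma integral in the extended reals: its functional equation is then
    available before its finiteness, and is used to prove it. *)
Definition egamma (R : realType) (a : R) : \bar R :=
  (\int[lebesgue_measure]_(x in `]0%R, +oo[) (gamma_integrand a x)%:E)%E.

Lemma gamma_integrand_ge0 (R : realType) (a x : R) : 0 <= gamma_integrand a x.
Proof. by rewrite mulr_ge0 ?powR_ge0 ?expR_ge0. Qed.

Lemma measurable_gamma_integrand (R : realType) (a : R) :
  measurable_fun [set: R] (gamma_integrand a).
Proof.
apply: measurable_funM; first exact: measurable_powR.
exact: measurableT_comp.
Qed.

(** Raise [y <= expR y], for [y = x / (2 * b)], to the power [b]. *)
Lemma powR_le_expR (R : realType) (b x : R) : 0 < b -> 0 < x ->
  x `^ b <= (2 * b) `^ b * expR (x / 2).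
Proof.
move=> b0 x0.
have b20 : 0 < 2 * b by rewrite mulr_gt0.
have y0 : 0 <= x / (2 * b) by rewrite divr_ge0 ?ltW.
have -> : x `^ b = (2 * b) `^ b * (x / (2 * b)) `^ b.
  by rewrite -powRM ?(ltW b20) // mulrC divfK // gt_eqF.
apply: ler_wpM2l; first exact: powR_ge0.
have -> : x / 2 = (x / (2 * b)) * b by field; rewrite gt_eqF.
rewrite expRM; apply: ge0_ler_powR; rewrite ?nnegrE ?expR_ge0 ?(ltW b0) //.
by have := expR_ge1Dx (x / (2 * b)); lra.
Qed.

(** For [1 < a] the integrand is dominated by a multiple of the exponential density
    of rate 1/2. *)
Lemma egamma_lty_gt1 (R : realType) (a : R) : 1 < a -> (egamma a < +oo)%E.
Proof.
move=> a1; pose C : R := 2 * (2 * (a - 1)) `^ (a - 1).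
have C0 : 0 <= C by rewrite mulr_ge0 ?powR_ge0.
apply: (@le_lt_trans _ _
    (\int[lebesgue_measure]_(x in `]0%R, +oo[) (C * exponential_pdf 2^-1 x)%:E)%E).
  apply: ge0_le_integral => //.
  - by move=> x _; rewrite lee_fin gamma_integrand_ge0.
  - apply/measurable_EFinP; apply: measurable_funTS.
    exact: measurable_gamma_integrand.
  - apply/measurable_EFinP; apply: measurable_funTS; apply: measurable_funM => //.
    exact: measurable_exponential_pdf.
  - move=> x; rewrite /= in_itv /= andbT => x0; rewrite lee_fin.
    rewrite exponential_pdfE ?(ltW x0) // /gamma_integrand.
    have a10 : 0 < a - 1 by rewrite subr_gt0.
    apply: le_trans.
      by apply: ler_wpM2r (powR_le_expR a10 x0); exact: expR_ge0.
    rewrite -mulrA -expRD /C.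
    have -> : x / 2 - x = - 2^-1 * x by field.
    by rewrite mulrACA divff // mul1r lexx.
apply: (@le_lt_trans _ _
    (\int[lebesgue_measure]_x (C * exponential_pdf 2^-1 x)%:E)%E).
  apply: ge0_subset_integral => //.
  - apply/measurable_EFinP; apply: measurable_funM => //.
    exact: measurable_exponential_pdf.
  - by move=> x _; rewrite lee_fin mulr_ge0 // exponential_pdf_ge0.
under eq_integral do rewrite EFinM.
rewrite ge0_integralZl_EFin //; last 2 first.
- by move=> x _; rewrite lee_fin exponential_pdf_ge0.
- by apply/measurable_EFinP; exact: measurable_exponential_pdf.
by rewrite integral_exponential_pdf // mule1 ltry.
Qed.

Lemma cvg_powR_expRN (R : realType) (b : R) : 0 < b ->
  n.+2%:R `^ b * expR (- n.+2%:R) @[n --> \oo] --> (0 : R).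
Proof.
move=> b0; set C : R := (2 * b) `^ b.
have cvgn : (n.+2%:R : R) @[n --> \oo] --> +oo.
  apply/cvgryPge => A; near=> n.
  have : A <= n%:R by near: n; exact: nbhs_infty_ger.
  by move=> /le_trans; apply; rewrite ler_nat leqW // leqW.
have cvge : C * expR (- (n.+2%:R / 2)) @[n --> \oo] --> 0.
  rewrite -(mulr0 C); apply: cvgMl_tmp.
  have := @cvgr_expR R; apply: cvg_comp.
  apply/cvgryPge => A; move/cvgryPge : cvgn => /(_ (2 * A)).
  by apply: filterS => n; rewrite ler_pdivlMr // mulrC.
apply: squeeze_cvgr cvge; last exact: cvg_cst.
near=> n; rewrite mulr_ge0 ?powR_ge0 ?expR_ge0 //=.
apply: (@le_trans _ _ (C * expR (n.+2%:R / 2) * expR (- n.+2%:R))).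
  by apply: ler_wpM2r; [exact: expR_ge0|exact: powR_le_expR].
rewrite -mulrA -expRD; set u := _ / 2 + _; set v := - (_ / 2).
suff -> : u = v by rewrite lexx.
by rewrite /u /v; field.
Unshelve. all: by end_near. Qed.

Lemma cvg_powRV (R : realType) (a : R) : 0 < a ->
  (1 / n.+2%:R) `^ a @[n --> \oo] --> (0 : R).
Proof.
move=> a0.
have /cvg_at_rightP := powR_cvg0 a0; apply; split=> [n|].
  by rewrite divr_gt0.
under eq_fun do rewrite div1r.
have := @cvg_harmonic R; rewrite -cvg_shiftS; exact.
Qed.

Lemma continuous_powR_gt0 (R : realType) (s x : R) : 0 < x ->
  {for x, continuous (fun y : R => y `^ s)}.
Proof.
move=> x0; apply: differentiable_continuous; apply/derivable1_diffP.
by apply: derivable_powR; rewrite in_itv /= x0.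
Qed.

Lemma within_continuous_gt0 (R : realType) (u v : R) (f : R -> R) : 0 < u ->
  (forall x : R, 0 < x -> {for x, continuous f}) ->
  {within `[u, v], continuous f}.
Proof.
move=> u0 cf; apply: continuous_in_subspaceT => x.
by rewrite inE /= in_itv /= => /andP[ux _]; apply: cf; exact: lt_le_trans ux.
Qed.

Lemma integral_gamma_by_parts (R : realType) (a u v : R) : 0 < u -> u < v ->
  (\int[lebesgue_measure]_(x in `[u, v]) (gamma_integrand (a + 1) x)%:E =
   (u `^ a * expR (- u) - v `^ a * expR (- v))%:E +
   a%:E * \int[lebesgue_measure]_(x in `[u, v]) (gamma_integrand a x)%:E)%E.
Proof.
move=> u0 uv; have v0 : 0 < v by exact: lt_trans uv.
pose F (x : R) := x `^ a; pose G (x : R) := - expR (- x).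
have dF (x : R) : 0 < x -> is_derive x 1 F (a * x `^ (a - 1)).
  by move=> x0; exact: is_derive1_powR.
have dG (x : R) : is_derive x 1 G (expR (- x)).
  by rewrite /G; apply: trigger_derive; rewrite mulrN1 opprK.
have cF (x : R) : 0 < x -> {for x, continuous F}.
  move=> /dF [dFx _]; apply: differentiable_continuous.
  exact/derivable1_diffP.
have cG (x : R) : {for x, continuous G}.
  have [dGx _] := dG x; apply: differentiable_continuous.
  exact/derivable1_diffP.
have ce (x : R) : {for x, continuous (fun x : R => expR (- x))}.
  by apply: continuous_comp; [exact: continuousN|exact: continuous_expR].
have pos x : x \in `[u, v] -> 0 < x.
  by rewrite in_itv /= => /andP[+ _]; exact: lt_le_trans.
under eq_integral do rewrite /gamma_integrand addrK.
have cgam : {within `[u, v], continuous (gamma_integrand a)}.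
  apply: within_continuous_gt0 => // x x0; apply: continuousM.
    exact: continuous_powR_gt0.
  exact: ce.
rewrite (@integration_by_parts R F G (fun x : R => a * x `^ (a - 1))
  (fun x : R => expR (- x))) //; last first.
- by move=> x _; have [_ <-] := dG x; rewrite derive1E.
- split=> [x _||].
  + by have [] := dG x.
  + by apply: cvg_at_right_filter; exact: cG.
  + by apply: cvg_at_left_filter; exact: cG.
- by apply: within_continuous_gt0 => // x _; exact: ce.
- move=> x xuv; have x0 : 0 < x by apply: pos; exact: subset_itv_oo_cc xuv.
  by have [_ <-] := dF x x0; rewrite derive1E.
- split=> [x xuv||].
  + have x0 : 0 < x by apply: pos; exact: subset_itv_oo_cc xuv.
    by have [] := dF x x0.
  + by apply: cvg_at_right_filter; exact: cF.
  + by apply: cvg_at_left_filter; exact: cF.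
- apply: within_continuous_gt0 => // x x0; apply: continuousM.
    exact: cst_continuous.
  exact: continuous_powR_gt0.
have -> : (\int[lebesgue_measure]_(x in `[u, v]) (a * x `^ (a - 1) * G x)%:E =
    (- a)%:E * \int[lebesgue_measure]_(x in `[u, v]) (gamma_integrand a x)%:E)%E.
  rewrite -integralZl //.
    apply: eq_integral => x _; rewrite -EFinM; congr EFin.
    by rewrite /G /gamma_integrand; ring.
  by apply: continuous_compact_integrable => //; exact: segment_compact.
rewrite EFinN mulNe oppeK; congr (_%:E + _)%E.
by rewrite /F /G; ring.
Qed.

(** Integrate by parts on [1 / n, n]: the boundary terms vanish in the limit. *)
Lemma egammaS (R : realType) (a : R) : 0 < a ->
  egamma (a + 1) = (a%:E * egamma a)%E.
Proof.
move=> a0.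
have mgam s : measurable_fun (`]0, +oo[ : set R) (gamma_integrand s).
  by apply: measurable_funTS; exact: measurable_gamma_integrand.
have gam0 s (x : R) : 0 < x -> 0 <= gamma_integrand s x.
  by move=> _; exact: gamma_integrand_ge0.
have lim1 := cvg_integral_exhaustion ltr01 (mgam (a + 1)) (gam0 _).
have lim2 := cvg_integral_exhaustion ltr01 (mgam a) (gam0 _).
have u0 n : 0 < 1 / n.+2%:R :> R by rewrite divr_gt0.
have uv n : 1 / n.+2%:R < 1 * n.+2%:R :> R.
  by rewrite ltr_pdivrMr // mul1r -natrM ltr1n.
move: lim1; under eq_cvg do rewrite (integral_gamma_by_parts a (u0 _) (uv _)).
move=> lim1; rewrite /egamma -(cvg_lim _ lim1) //.
apply/cvg_lim => //.
rewrite -[X in _ --> X]add0e; apply: cvgeD.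
- by rewrite fin_num_adde_defr.
- apply: cvg_EFin; first exact: nearW.
  rewrite -(subr0 0); apply: cvgB.
    apply: squeeze_cvgr (cvg_powRV a0); last exact: cvg_cst.
    apply: nearW => n; rewrite mulr_ge0 ?powR_ge0 ?expR_ge0 //=.
    by rewrite ler_piMr ?powR_ge0 // expR_le1 oppr_le0 divr_ge0.
  under eq_fun do rewrite mul1r.
  exact: cvg_powR_expRN.
- exact: cvgeZl.
Qed.

(** The functional equation brings [a] into the range [1 < a]. *)
Lemma egamma_lty (R : realType) (a : R) : 0 < a -> (egamma a < +oo)%E.
Proof.
move=> a0; have := @egamma_lty_gt1 R (a + 1); rewrite ltrDr => /(_ a0).
rewrite egammaS //; case: (egamma a) => [x| |//]; first by move=> _; exact: ltry.
by rewrite gt0_muley ?lte_fin.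
Qed.

Lemma egammaE (R : realType) (a : R) : 0 < a -> egamma a = (Gamma a)%:E.
Proof.
move=> a0; rewrite /Gamma /Rintegral fineK // ge0_fin_numE ?egamma_lty //.
by apply: integral_ge0 => x _; rewrite lee_fin gamma_integrand_ge0.
Qed.

Lemma GammaS (R : realType) (a : R) : 0 < a -> Gamma (a + 1) = a * Gamma a.
Proof.
by move=> a0; have := egammaS a0; rewrite !egammaE ?addr_gt0 // -EFinM => -[].
Qed.

(** By the functional equation it is enough to treat [a + 1], whose integrand is at
    least [expR (- 2)] on the interval from 1 to 2. *)
Lemma Gamma_gt0 (R : realType) (a : R) : 0 < a -> 0 < Gamma a.
Proof.
move=> a0; rewrite -(pmulr_rgt0 _ a0) -GammaS // -lte_fin -egammaE ?addr_gt0 //.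
have : ((expR (- 2))%:E <= egamma (a + 1))%E.
  apply: (@le_trans _ _
      (\int[lebesgue_measure]_(x in `[1%R, 2%R]) (expR (- 2))%:E)%E).
    rewrite integral_cst //= lebesgue_measure_itv /= lte_fin ltr1n.
    by rewrite -EFinB -EFinM lee_fin; set e := expR _; lra.
  apply: (@le_trans _ _ (\int[lebesgue_measure]_(x in `[1%R, 2%R])
      (gamma_integrand (a + 1) x)%:E)%E).
    apply: ge0_le_integral => //.
    - apply/measurable_EFinP; apply: measurable_funTS.
      exact: measurable_gamma_integrand.
    - move=> x; rewrite /= in_itv /= => /andP[x1 x2]; rewrite lee_fin.
      rewrite /gamma_integrand addrK -[leLHS]mul1r ler_pM ?expR_ge0 //.
        by rewrite -(powRr0 x) ler_powR // ltW.
      by rewrite ler_expR lerN2.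
  apply: ge0_subset_integral => //.
  - apply/measurable_EFinP; apply: measurable_funTS.
    exact: measurable_gamma_integrand.
  - by move=> x _; rewrite lee_fin gamma_integrand_ge0.
  - by move=> x; rewrite /= !in_itv /= andbT => /andP[+ _]; apply: lt_le_trans.
by apply: lt_le_trans; rewrite lte_fin expR_gt0.
Qed.

Lemma Gamma_pochhammer (R : realType) (a : R) (r : nat) : 0 < a ->
  Gamma (a + r%:R) = pochhammer r a * Gamma a.
Proof.
move=> a0; elim: r => [|r IH]; first by rewrite addr0 /pochhammer big_ord0 mul1r.
rewrite -natr1 addrA GammaS ?ltr_wpDr // IH /pochhammer big_ord_recr /=; ring.
Qed.

(** Substitute [x = 2 * y]. *)
Lemma integral_gamma_scale2 (R : realType) (s : R) : 0 < s ->
  (\int[lebesgue_measure]_(x in `]0%R, +oo[) (x `^ (s - 1) * expR (- x / 2))%:E =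
   (2 `^ s * Gamma s)%:E)%E.
Proof.
move=> s0; rewrite EFinM -egammaE //.
pose h (x : R) := x `^ (s - 1) * expR (- x / 2).
have mh : measurable_fun [set: R] h.
  apply: measurable_funM; first exact: measurable_powR.
  by apply: measurableT_comp => //; exact: measurable_funM.
have h0 (x : R) : 0 < x -> 0 <= h x.
  by move=> _; rewrite mulr_ge0 ?powR_ge0 ?expR_ge0.
have lim1 := cvg_integral_exhaustion (ltr0Sn R 1) (measurable_funTS mh) h0.
have lim2 :=
  cvg_integral_exhaustion ltr01 (measurable_funTS (measurable_gamma_integrand s))
  (fun x _ => gamma_integrand_ge0 s x).
have ch (x : R) : 0 < x -> {for x, continuous h}.
  move=> x0; apply: continuousM; first exact: continuous_powR_gt0.
  apply: (@continuous_comp _ _ _ (fun y : R => - y / 2)).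
    by apply: continuousM; [exact: continuousN|exact: cst_continuous].
  exact: continuous_expR.
have subst n :
    (\int[lebesgue_measure]_(x in `[(2 / n.+2%:R)%R, (2 * n.+2%:R)%R]) (h x)%:E =
    (2 `^ s)%:E *
    \int[lebesgue_measure]_(x in `[(1 / n.+2%:R)%R, (1 * n.+2%:R)%R])
      (gamma_integrand s x)%:E)%E.
  pose F (x : R) := 2 * x.
  have dF (x : R) : is_derive x 1 F 2.
    by rewrite /F; apply: trigger_derive; exact: mulr1.
  have F'E : F^`()%classic = cst 2.
    by apply/funext => x; rewrite derive1E; have [_ ->] := dF x.
  have cF (x : R) : {for x, continuous F}.
    have [dFx _] := dF x; apply: differentiable_continuous.
    exact/derivable1_diffP.
  have u0 : 0 < 1 / n.+2%:R :> R by rewrite divr_gt0.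
  have uv : 1 / n.+2%:R < 1 * n.+2%:R :> R.
    by rewrite ltr_pdivrMr // mul1r -natrM ltr1n.
  have -> : 2 / n.+2%:R = F (1 / n.+2%:R) by rewrite /F mulrA mulr1.
  have -> : 2 * n.+2%:R = F (1 * n.+2%:R) by rewrite /F mul1r.
  rewrite integration_by_substitution_increasing ?F'E ?ltW //.
  - rewrite -integralZl //.
      apply: eq_integral => x; rewrite inE /= in_itv /= => /andP[ux _].
      have x0 : 0 < x by exact: lt_le_trans ux.
      rewrite -EFinM; congr EFin.
      rewrite /h /F /gamma_integrand /= !fctE /=.
      have -> : - (2 * x) / 2 = - x by field.
      by rewrite powRM ?(ltW x0) // -(mulr_powRB1 (ler0n R 2) s0); ring.
    apply: continuous_compact_integrable; first exact: segment_compact.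
    apply: within_continuous_gt0 => // x x0; apply: continuousM.
      exact: continuous_powR_gt0.
    by apply: continuous_comp; [exact: continuousN|exact: continuous_expR].
  - by move=> x y _ _ xy; rewrite /F ltr_pM2l.
  - by move=> x _; exact: cst_continuous.
  - exact: is_cvg_cst.
  - exact: is_cvg_cst.
  - split=> [x _||].
    + by have [] := dF x.
    + by apply: cvg_at_right_filter; exact: cF.
    + by apply: cvg_at_left_filter; exact: cF.
  - by apply: within_continuous_gt0 => //; rewrite /F mulr_gt0.
move: lim1; under eq_cvg do rewrite subst.
move=> /cvg_lim <- //; apply/cvg_lim => //; exact: cvgeZl.
Qed.

(** * Integration against a conditional density *)

Section density_transfer.
Local Open Scope ereal_scope.
Import HBNNSimple.

(** The hypothesis says that, on the event [D], the variable [Y] has density [g]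
    with respect to [mu]; it extends from indicators to nonnegative functions by
    linearity and monotone convergence. *)
Lemma ge0_integral_density_transfer (d d' : measure_display)
    (T : measurableType d) (T' : measurableType d') (R : realType)
    (P : {measure set T -> \bar R}) (mu : {measure set T' -> \bar R})
    (Y : T -> T') (D : set T) (f : T' -> \bar R) (g : T' -> R) :
  measurable D -> measurable_fun [set: T] Y ->
  measurable_fun [set: T'] g -> (forall x, 0 <= g x)%R ->
  measurable_fun [set: T'] f -> (forall x, 0 <= f x) ->
  (forall A, measurable A -> P (D `&` Y @^-1` A) = \int[mu]_(x in A) (g x)%:E) ->
  \int[P]_(x in D) f (Y x) = \int[mu]_x (f x * (g x)%:E).
Proof.
move=> mD mY mg g0 mf f0 PDY.
pose f_ := nnsfun_approx measurableT mf.
pose A n r := f_ n @^-1` [set r].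
have mA n r : measurable (A n r) by exact: measurable_funPTI.
have f_E n x : (f_ n x)%:E =
    \sum_(r \in range (f_ n)) (r%:E * (\1_(A n r) x)%:E).
  by rewrite fimfunE -fsumEFin.
have f_cvg x : (f_ n x)%:E @[n --> \oo] --> f x.
  by apply: (cvg_nnsfun_approx measurableT mf).
have f_nd x m n : (m <= n)%N -> (f_ m x <= f_ n x)%R.
  by move=> mn; exact/lefP/nd_nnsfun_approx.
have mf_ n : measurable_fun [set: T'] (fun x => (f_ n x)%:E).
  exact/measurable_EFinP.
have range_ge0 n r : r \in range (f_ n) -> (0 <= r)%R.
  by rewrite inE => -[x _ <-].
have mgE : measurable_fun [set: T'] (EFin \o g) by exact/measurable_EFinP.
have m1 n r : measurable_fun [set: T'] (fun x => (\1_(A n r) x)%:E : \bar R).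
  exact/measurable_EFinP.
have step n : \int[P]_(x in D) (f_ n (Y x))%:E =
    \int[mu]_x ((f_ n x)%:E * (g x)%:E).
  transitivity (\sum_(r \in range (f_ n))
      r%:E * \int[mu]_(x in A n r) (g x)%:E).
    under eq_integral do rewrite f_E.
    rewrite ge0_integral_fsum //.
    - apply: eq_fsbigr => r /range_ge0 r0.
      rewrite ge0_integralZl_EFin //; last first.
        by apply: measurable_funTS; apply: measurableT_comp (m1 n r) mY.
      rewrite -PDY // setIC -integral_indic //.
      by rewrite -[X in measurable X]setTI; exact: mY.
    - move=> r; apply: measurable_funeM; apply: measurable_funTS.
      exact: measurableT_comp (m1 n r) mY.
    - by move=> r x _; exact: nnfun_muleindic_ge0.
  transitivity (\int[mu]_x \sum_(r \in range (f_ n))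
      (r%:E * ((\1_(A n r) x)%:E * (g x)%:E))).
    rewrite ge0_integral_fsum //.
    - apply: eq_fsbigr => r /range_ge0 r0.
      rewrite ge0_integralZl_EFin //.
      + congr (_ * _); rewrite integral_mkcond; apply: eq_integral => x _.
        by rewrite patchE indicE; case: ifP; rewrite ?mul1e ?mul0e.
      + by move=> x _; rewrite mule_ge0 // lee_fin.
      + exact: emeasurable_funM.
    - by move=> r; apply: measurable_funeM; exact: emeasurable_funM.
    - move=> r x _; rewrite muleA mule_ge0 ?lee_fin //.
      exact: nnfun_muleindic_ge0.
  apply: eq_integral => x _; rewrite f_E ge0_mule_fsuml.
    by apply: eq_fsbigr => r _; rewrite muleA.
  by move=> r; exact: nnfun_muleindic_ge0.
transitivity (limn (fun n => \int[P]_(x in D) (f_ n (Y x))%:E)).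
  rewrite -monotone_convergence //.
  - by apply: eq_integral => x _; apply/esym/cvg_lim => //; exact: f_cvg.
  - by move=> n; apply: measurable_funTS; exact: measurableT_comp (mf_ n) mY.
  - by move=> n x _; rewrite lee_fin.
  - by move=> x _ m n mn; rewrite lee_fin f_nd.
under eq_fun do rewrite step.
rewrite -monotone_convergence //.
- by apply: eq_integral => x _; apply/cvg_lim => //; exact: cvgeZr.
- by move=> n; exact: emeasurable_funM.
- by move=> n x _; rewrite mule_ge0 // lee_fin.
- by move=> x _ m n mn; apply: lee_wpmul2r; rewrite lee_fin ?g0 // f_nd.
Qed.

End density_transfer.

(** * Moments of chi-squared laws *)

Lemma chi2_pdf_ge0 (R : realType) (k x : R) : 0 < k -> 0 <= chi2_pdf k x.
Proof.
move=> k0; rewrite /chi2_pdf; case: ifP => // _.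
by rewrite divr_ge0 ?mulr_ge0 ?powR_ge0 ?expR_ge0 // ltW // Gamma_gt0 // divr_gt0.
Qed.

Lemma measurable_chi2_pdf (R : realType) (k : R) :
  measurable_fun [set: R] (chi2_pdf k).
Proof.
apply: measurable_fun_if => //; first exact: measurable_fun_ltr.
apply: measurable_funTS; apply: measurable_funM => //.
apply: measurable_funM; first exact: measurable_powR.
by apply: measurableT_comp => //; exact: measurable_funM.
Qed.

(** The integrand is a Gamma integrand of parameter [k / 2 + r], scaled by 2, and
    [Gamma (k / 2 + r) / Gamma (k / 2)] is a rising factorial. *)
Lemma chi2_moment (R : realType) (k : R) (r : nat) : 0 < k ->
  (\int[lebesgue_measure]_x (x ^+ r * chi2_pdf k x)%:E =
   (2 ^+ r * pochhammer r (k / 2))%:E)%E.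
Proof.
move=> k0; set h := k / 2.
have h0 : 0 < h by rewrite divr_gt0.
have hr0 : 0 < h + r%:R by rewrite ltr_wpDr.
pose c : R := (2 `^ h * Gamma h)^-1.
transitivity (\int[lebesgue_measure]_(x in `]0%R, +oo[)
  (c%:E * (x `^ (h + r%:R - 1) * expR (- x / 2))%:E))%E.
  rewrite [RHS]integral_mkcond; apply: eq_integral => x _.
  rewrite patchE mem_setE in_itv /= andbT /chi2_pdf.
  case: ifPn => [x0|_]; last by rewrite mulr0.
  rewrite -EFinM; congr EFin.
  rewrite addrAC [x `^ (_ + r%:R)]powRD ?(gt_eqF x0) ?implybT //.
  rewrite powR_mulrn ?(ltW x0) //.
  by rewrite /c -/h; ring.
rewrite ge0_integralZl_EFin //; last 3 first.
- by move=> x _; rewrite lee_fin mulr_ge0 ?powR_ge0 ?expR_ge0.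
- apply/measurable_EFinP; apply: measurable_funTS; apply: measurable_funM.
    exact: measurable_powR.
  by apply: measurableT_comp => //; exact: measurable_funM.
- by rewrite invr_ge0 mulr_ge0 ?powR_ge0 ?ltW ?Gamma_gt0.
rewrite integral_gamma_scale2 // -EFinM Gamma_pochhammer //; congr EFin.
rewrite [2 `^ (_ + r%:R)]powRD ?pnatr_eq0 ?implybT // powR_mulrn // /c.
have p0 : 2 `^ h != 0 by rewrite gt_eqF ?powR_gt0.
have G0 : Gamma h != 0 by rewrite gt_eqF ?Gamma_gt0.
by field; rewrite p0 G0.
Qed.

(** Split the expectation according to the value of the mixing Poisson variable.
    Only the law [mu] matters, so the computation can be carried out on the
    space that carries this variable. *)
Lemma noncentral_chi2_integral (R : realType) (g lambda : R)
    (mu : {measure set R -> \bar R})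
    (f : R -> \bar R) :
  0 < g -> 0 <= lambda -> noncentral_chi2 g lambda mu ->
  measurable_fun [set: R] f -> (forall x, 0 <= f x)%E ->
  (\int[mu]_x f x =
   \sum_(0 <= j <oo) (poisson_weight (lambda / 2) j)%:E *
     \int[lebesgue_measure]_x (f x * (chi2_pdf (g + 2 * j%:R) x)%:E))%E.
Proof.
move=> g0 l0 [d' [T' [P [Y [M [YE ME YME]]]]]] mf f0.
have k0 j : 0 < g + 2 * j%:R by rewrite ltr_wpDr // mulr_ge0.
have w0 j : 0 <= poisson_weight (lambda / 2) j.
  by rewrite poisson_weight_ge0 // divr_ge0.
have PM j : P (M @^-1` [set j]) = (poisson_weight (lambda / 2) j)%:E.
  by rewrite -poisson_prob1 ?divr_ge0 // -ME.
rewrite (@eq_measure_integral _ _ _ _ (distribution P Y)); last first.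
  by move=> A mA _; apply: esym; exact: YE.
rewrite ge0_integral_distribution //.
have MT : \bigcup_j (M @^-1` [set j]) = [set: T'].
  by apply/seteqP; split=> // x _; exists (M x).
rewrite -MT ge0_integral_bigcup //=; last 3 first.
- by move=> j; exact: measurable_funPTI.
- by apply: measurable_funTS; exact: measurableT_comp.
- by move=> i j _ _ [x [/= <- <-]].
apply: eq_eseriesr => j _.
have mw : measurable_fun [set: R]
    (fun x => poisson_weight (lambda / 2) j * chi2_pdf (g + 2 * j%:R) x).
  by apply: measurable_funM => //; exact: measurable_chi2_pdf.
rewrite (@ge0_integral_density_transfer _ _ _ (measurableTypeR R) _ _
  lebesgue_measure Y _ f
  (fun x => poisson_weight (lambda / 2) j * chi2_pdf (g + 2 * j%:R) x)) //.
- rewrite -ge0_integralZl_EFin //.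
  + by apply: eq_integral => x _; rewrite EFinM muleCA.
  + by move=> x _; rewrite mule_ge0 // lee_fin chi2_pdf_ge0.
  + apply: emeasurable_funM => //; apply/measurable_EFinP.
    exact: measurable_chi2_pdf.
- exact: measurable_funPTI.
(* The target of [Y] is the real line under another display, with the same
   Borel sets: the proof is accepted by conversion only. *)
- exact (measurable_funPT Y).
- by move=> x; rewrite mulr_ge0 // chi2_pdf_ge0.
move=> A mA; apply: eq_trans (YME j A mA) _.
rewrite PM /chi2_prob -ge0_integralZl_EFin //.
- by move=> x _; rewrite lee_fin chi2_pdf_ge0.
- by apply/measurable_EFinP; apply: measurable_funTS; exact: measurable_chi2_pdf.
Qed.

Unset Implicit Arguments.

Theorem proposition3p2 (R : realType) (d : measure_display)
    (T : measurableType d) (P : probability T R) (g lambda : R)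
    (Y : {RV P >-> R}) (r : nat)
    (hg : 0 < g) (hlambda : 0 <= lambda)
    (hY : noncentral_chi2 g lambda (distribution P Y))
    (hr : (1 <= r)%N) :
  ('E_P[(fun w => Y w ^+ r)%R] =
  (2 ^+ r * \sum_(0 <= i < r.+1) \sum_(0 <= j < i.+1)
     (stirling2 i j)%:R * (i`!%:R)^-1 * derive1n i (@pochhammer R r) (g / 2)
       * (lambda / 2) ^+ j)%R%:E)%E.
Proof.
pose h (x : R) : \bar R := (x ^+ r)%:E.
have mh : measurable_fun [set: R] h.
  by apply/measurable_EFinP; exact: measurable_funX.
have k0 j : 0 < g + 2 * j%:R by rewrite ltr_wpDr // mulr_ge0.
rewrite unlock (_ : integral _ _ _ = \int[P]_w (h \o Y) w)%E //.
(* For odd [r] the integrand is signed on the whole line; the negative part has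
   integral 0 because the densities vanish there. *)
rewrite integralE funepos_comp funeneg_comp.
rewrite -!ge0_integral_distribution //; last 2 first.
- exact: measurable_funeneg.
- exact: measurable_funepos.
rewrite !(noncentral_chi2_integral hg hlambda hY) //; last 2 first.
- exact: measurable_funeneg.
- exact: measurable_funepos.
rewrite [X in (_ - X)%E]eseries0 ?sube0 => [|j _ _]; last first.
  rewrite integral0_eq ?mule0 // => x _; rewrite /chi2_pdf.
  case: ifPn => x0; last by rewrite mule0.
  by rewrite funenegE (max_idPr _) ?mul0e // oppe_le0 lee_fin exprn_ge0 // ltW.
have moment j :
    (\int[lebesgue_measure]_x (h^\+ x * (chi2_pdf (g + 2 * j%:R) x)%:E) =
     (2 ^+ r * pochhammer r (g / 2 + j%:R))%:E)%E.
  have -> : g / 2 + j%:R = (g + 2 * j%:R) / 2 by field.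
  rewrite -chi2_moment //; apply: eq_integral => x _; rewrite EFinM /chi2_pdf.
  case: ifPn => x0; last by rewrite !mule0.
  by rewrite funeposE (max_idPl _) // lee_fin exprn_ge0 // ltW.
under eq_eseriesr do rewrite moment -EFinM.
apply/cvg_lim => //.
have partial N : (\sum_(0 <= j < N) (poisson_weight (lambda / 2) j *
      (2 ^+ r * pochhammer r (g / 2 + j%:R)))%:E)%E =
    (2 ^+ r * series (fun j => poisson_weight (lambda / 2) j *
      pochhammer r (g / 2 + j%:R)) N)%:E.
  rewrite sumEFin /series /= mulr_sumr; congr EFin.
  by apply: eq_bigr => j _; rewrite mulrCA.
under eq_cvg do rewrite partial.
apply: cvg_EFin; first exact: nearW.
apply: cvgMl_tmp; exact: poisson_pochhammer.
Qed.
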